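(* Let $G\subset \mathbb{S}^{d-1}$ be a set of directions such that (C1) the open half-spaces $H_u$ with $u\in G$ cover $\mathbb{S}^{d-1}$, and (C2) the reflections $\{R_u\mid u\in G\}$ generate a dense subgroup of $O(d)$. Then there exists a sequence $(u_n)_{n\ge 1}$ in $G$ such that for every starting point $x\in\mathbb{S}^{d-1}$, the trajectory defined by $x_0=x$, $x_n=F_{u_n}(x_{n-1})$ for $n\ge 1$, is dense in $\mathbb{S}^{d-1}$.
   Context: $\mathbb{S}^{d-1}$ is the set of unit vectors in $\mathbb{R}^d$; $O(d)$ is the group of orthogonal linear transformations of $\mathbb{R}^d$. For $u\in\mathbb{S}^{d-1}$: $R_u x=x-2(x\cdot u)u$ is the reflection about $u^\perp$; $H_u=\{x\in\mathbb{R}^d\mid x\cdot u>0\}$ is the open positive half-space; the folding map $F_u$ is defined by $F_u(x)=x$ if $x\in H_u$ and $F_u(x)=R_ux$ otherwise. *)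

(* Defs.v *)
From HB Require Import structures.
From mathcomp Require Import all_boot all_order all_algebra.
From mathcomp Require Import all_classical all_reals all_analysis.

Set Implicit Arguments.
Unset Strict Implicit.
Unset Printing Implicit Defensive.

Import Order.TTheory GRing.Theory Num.Theory.
Import numFieldNormedType.Exports.

Local Open Scope classical_set_scope.
Local Open Scope ring_scope.

(* Euclidean R^d is the type of row vectors 'rV[R]_d. The library's norm on
   it is the sup norm, so the Euclidean structure is introduced through the
   dot product; the topology is the same. *)
Section Folding.
Variables (R : realType) (d : nat).
Implicit Types (u x y : 'rV[R]_d) (G : set 'rV[R]_d).

Definition dotv x y : R := \sum_(i < d) x 0 i * y 0 i.

Definition unit_sphere : set 'rV[R]_d := [set x | dotv x x = 1].

Definition reflection u x : 'rV[R]_d := x - (2 * dotv x u) *: u.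

Fact reflection_is_linear u : linear (reflection u).
Proof.
move=> a x y; rewrite /reflection.
have -> : dotv (a *: x + y) u = a * dotv x u + dotv y u.
  rewrite /dotv mulr_sumr -big_split /=; apply: eq_bigr => i _.
  by rewrite !mxE mulrDl mulrA.
by rewrite mulrDr scalerDl scalerBr scalerA mulrCA opprD addrACA.
Qed.

HB.instance Definition _ u :=
  GRing.isLinear.Build R 'rV[R]_d 'rV[R]_d _ (reflection u)
    (reflection_is_linear u).

Definition open_half_space u : set 'rV[R]_d := [set x | 0 < dotv x u].

Definition fold u x : 'rV[R]_d :=
  if 0 < dotv x u then x else reflection u x.

(* A linear map f of R^d is represented by its matrix [lin1_mx f], which acts
   on row vectors from the right: x *m lin1_mx f = f x. Hence a product
   A *m B represents "first A, then B". *)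
Definition orthogonal_group : set 'M[R]_d := [set A | A *m A^T = 1%:M].

Definition orthogonal_subgroup (H : set 'M[R]_d) : Prop :=
  [/\ H `<=` orthogonal_group, H 1%:M,
      forall A B, H A -> H B -> H (A *m B)
    & forall A, H A -> H (invmx A)].

Definition reflection_group G : set 'M[R]_d :=
  smallest orthogonal_subgroup [set lin1_mx (reflection u) | u in G].

(* [us 0] plays no role: step n (n >= 1) folds along [us n]. *)
Fixpoint trajectory (us : nat -> 'rV[R]_d) x (n : nat) : 'rV[R]_d :=
  if n is m.+1 then fold (us n) (trajectory us x m) else x.

End Folding.

Arguments unit_sphere {R d}.
Arguments orthogonal_group {R d}.

(* Relative density: the library's [dense] is density in the whole space. *)
Definition dense_in (T : topologicalType) (B A : set T) : Prop :=
  A `<=` B /\ B `<=` closure A.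

(* Main.v *)
(* Folds are 1-Lipschitz, so by a finite-net argument it is enough to steer any
   single point x near any single point y. To do so, let f be the support
   function of the set of points reachable from x; it satisfies f <= f o F_u
   for u in G. The barycentre m of the sphere weighted by f satisfies
     m.u = int (f - f o R_u) (x.u)^+ >= 0   for all u in G,
   so m = 0 by (C1), the integrand vanishes, f is invariant under all R_u, and
   hence constant by (C2). The integral against the invariant measure is
   replaced by the mean over a maximal e-separated subset of the sphere, which
   is invariant up to an error of order e on Lipschitz functions. *)
Require Import Defs.
From HB Require Import structures.
From mathcomp Require Import all_boot all_order all_algebra.
From mathcomp Require Import all_classical all_reals all_analysis.
From mathcomp Require Import ring lra.

Set Implicit Arguments.
Unset Strict Implicit.
Unset Printing Implicit Defensive.

Import Order.TTheory GRing.Theory Num.Theory.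
Import numFieldNormedType.Exports.

Local Open Scope classical_set_scope.
Local Open Scope ring_scope.

(** * Euclidean geometry of reflections and folds *)

Section Euclidean.
Context {R : realType} {d : nat}.
Implicit Types (x y z u : 'rV[R]_d) (A : 'M[R]_d).

Lemma dotvC x y : dotv x y = dotv y x.
Proof. by apply: eq_bigr => i _; rewrite mulrC. Qed.

Lemma dotvDl x y z : dotv (x + y) z = dotv x z + dotv y z.
Proof. by rewrite -big_split; apply: eq_bigr => i _; rewrite mxE mulrDl. Qed.

Lemma dotvZl (a : R) x y : dotv (a *: x) y = a * dotv x y.
Proof. by rewrite mulr_sumr; apply: eq_bigr => i _; rewrite mxE mulrA. Qed.

Lemma dotvNl x y : dotv (- x) y = - dotv x y.
Proof. by rewrite -scaleN1r dotvZl mulN1r. Qed.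

Lemma dotvDr x y z : dotv z (x + y) = dotv z x + dotv z y.
Proof. by rewrite dotvC dotvDl !(dotvC z). Qed.

Lemma dotvZr (a : R) x y : dotv y (a *: x) = a * dotv y x.
Proof. by rewrite dotvC dotvZl dotvC. Qed.

Lemma dotvNr x y : dotv y (- x) = - dotv y x.
Proof. by rewrite dotvC dotvNl dotvC. Qed.

Definition dotv_lin := (dotvDl, dotvDr, dotvNl, dotvNr, dotvZl, dotvZr).

Lemma dotv_suml (I : Type) (s : seq I) (F : I -> 'rV[R]_d) y :
  dotv (\sum_(i <- s) F i) y = \sum_(i <- s) dotv (F i) y.
Proof.
elim: s => [|i s IH]; last by rewrite !big_cons dotvDl IH.
by rewrite !big_nil; apply: big1 => i _; rewrite mxE mul0r.
Qed.

Lemma dotv_ge0 x : 0 <= dotv x x.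
Proof. by apply: sumr_ge0 => i _; rewrite -expr2 sqr_ge0. Qed.

Lemma sqr_coord_le x i : x 0 i ^+ 2 <= dotv x x.
Proof.
rewrite /dotv (bigD1 i) //= -expr2 lerDl.
by apply: sumr_ge0 => j _; rewrite -expr2 sqr_ge0.
Qed.

(** The norm that orthogonal maps preserve; two-sided bounds against the sup norm carry estimates
    over to the topology. *)
Definition enorm x : R := Num.sqrt (dotv x x).

Lemma enorm_ge0 x : 0 <= enorm x.
Proof. exact: sqrtr_ge0. Qed.

Lemma sqr_enorm x : enorm x ^+ 2 = dotv x x.
Proof. by rewrite sqr_sqrtr // dotv_ge0. Qed.

Lemma enorm_eq0 x : (enorm x == 0) = (x == 0).
Proof.
apply/idP/eqP => [/eqP x0|->]; last first.
  by rewrite /enorm /dotv big1 ?sqrtr0 // => i _; rewrite mxE mul0r.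
apply/rowP => i; rewrite mxE; apply/eqP; rewrite -sqrf_eq0 eq_le sqr_ge0 andbT.
by rewrite (le_trans (sqr_coord_le x i)) // -sqr_enorm x0 expr0n.
Qed.

Lemma enormB x y : enorm (x - y) = enorm (y - x).
Proof. by rewrite -opprB /enorm dotvNl dotvNr opprK. Qed.

Lemma ler_enorm x y : (enorm x <= enorm y) = (dotv x x <= dotv y y).
Proof. by rewrite -!sqr_enorm ler_pXn2r // nnegrE enorm_ge0. Qed.

Lemma dotv_le_enorm u x : unit_sphere u -> `|dotv x u| <= enorm x.
Proof.
move=> u1; have /= {}u1 : dotv u u = 1 := u1.
have := dotv_ge0 (x - dotv x u *: u).
rewrite !dotv_lin (dotvC u x) u1 => h.
rewrite -(@ler_pXn2r _ 2) ?nnegrE ?enorm_ge0 // sqr_enorm real_normK ?num_real //.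
by lra.
Qed.

Lemma norm_le_enorm x : `|x| <= enorm x.
Proof.
rewrite [leLHS]/Num.norm /= mx_normrE; apply/bigmax_leP; split=> [|[i j] _] /=.
  exact: enorm_ge0.
rewrite -(@ler_pXn2r _ 2) ?nnegrE ?enorm_ge0 // sqr_enorm real_normK ?num_real //.
by rewrite ord1; exact: sqr_coord_le.
Qed.

Lemma coord_le_norm (m n : nat) (M : 'M[R]_(m, n)) i j : `|M i j| <= `|M|.
Proof.
rewrite [leRHS]/Num.norm /= mx_normrE.
by apply/bigmax_geP; right; exists (i, j).
Qed.

Lemma enorm_le_norm x : enorm x <= d%:R * `|x|.
Proof.
rewrite -(@ler_pXn2r _ 2) ?nnegrE ?enorm_ge0 ?mulr_ge0 // sqr_enorm exprMn.
have le1 : dotv x x <= d%:R * `|x| ^+ 2.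
  rewrite -[d in d%:R]card_ord mulr_natl -sumr_const; apply: ler_sum => i _.
  by rewrite -expr2 -[leLHS]real_normK ?num_real // ler_pXn2r ?nnegrE ?coord_le_norm.
apply: le_trans le1 _; rewrite ler_wpM2r ?sqr_ge0 // -natrX ler_nat.
by case: d => // n; rewrite expnS leq_pmulr // expn1.
Qed.

Lemma sphere_dist x y : unit_sphere x -> unit_sphere y ->
  dotv (x - y) (x - y) = 2 - 2 * dotv x y.
Proof.
move=> x1 y1; have /= {}x1 : dotv x x = 1 := x1.
have /= {}y1 : dotv y y = 1 := y1.
by rewrite !dotv_lin x1 y1 (dotvC y x); ring.
Qed.

Lemma sphere_enorm x : unit_sphere x -> enorm x = 1.
Proof. by move=> x1; rewrite /enorm (x1 : dotv x x = 1) sqrtr1. Qed.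

Lemma dotv_reflection u x y : unit_sphere u ->
  dotv (reflection u x) (reflection u y) = dotv x y.
Proof.
move=> u1; have /= {}u1 : dotv u u = 1 := u1.
by rewrite /reflection !dotv_lin u1 (dotvC u y); ring.
Qed.

Lemma dotv_reflectionl u x : unit_sphere u ->
  dotv (reflection u x) u = - dotv x u.
Proof.
move=> u1; have /= {}u1 : dotv u u = 1 := u1.
by rewrite /reflection !dotv_lin u1; ring.
Qed.

Lemma reflectionK u : unit_sphere u -> involutive (reflection u).
Proof.
move=> u1 x; rewrite {1}/reflection dotv_reflectionl // /reflection.
by rewrite mulrN scaleNr opprK subrK.
Qed.

Lemma sphere_reflection u x : unit_sphere u -> unit_sphere x ->
  unit_sphere (reflection u x).
Proof. by move=> u1 x1; rewrite /unit_sphere /= dotv_reflection. Qed.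

Lemma sphere_fold u x : unit_sphere u -> unit_sphere x ->
  unit_sphere (fold u x).
Proof. by rewrite /fold; case: ifP => // _; exact: sphere_reflection. Qed.

(** If both points or neither are reflected, the inner product is kept; if only one is, it gains
    $-2(x\cdot u)(y\cdot u)\ge 0$. *)
Lemma dotv_fold u x y : unit_sphere u ->
  dotv x y <= dotv (fold u x) (fold u y).
Proof.
move=> u1; rewrite /fold; case: ltP => xu; case: ltP => yu //.
- rewrite /reflection !dotv_lin; nra.
- rewrite /reflection !dotv_lin (dotvC u y); nra.
- by rewrite dotv_reflection.
Qed.

Lemma enorm_fold u x y : unit_sphere u ->
  enorm (fold u x - fold u y) <= enorm (x - y).
Proof.
move=> u1; rewrite ler_enorm !dotv_lin.
have sq z : dotv (fold u z) (fold u z) = dotv z z.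
  by rewrite /fold; case: ifP => // _; rewrite dotv_reflection.
by have := dotv_fold x y u1; rewrite !sq (dotvC y) (dotvC (fold u y)); lra.
Qed.

Lemma dotv_orthogonal A x y : orthogonal_group A ->
  dotv (x *m A) (y *m A) = dotv x y.
Proof.
have dotvE v w : dotv v w = (v *m w^T) 0 0.
  by rewrite mxE; apply: eq_bigr => i _; rewrite mxE.
by move=> A1; rewrite !dotvE trmx_mul mulmxA -(mulmxA x) (A1 : A *m A^T = _) mulmx1.
Qed.

Lemma sphere_orthogonal A x : orthogonal_group A ->
  unit_sphere x -> unit_sphere (x *m A).
Proof. by move=> A1 x1; rewrite /unit_sphere /= dotv_orthogonal. Qed.

Lemma enorm_orthogonal A x : orthogonal_group A -> enorm (x *m A) = enorm x.
Proof. by move=> A1; rewrite /enorm dotv_orthogonal. Qed.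

Lemma orthogonal_reflection u : unit_sphere u ->
  orthogonal_group (lin1_mx (reflection u)).
Proof.
move=> u1; apply/matrixP => i j; rewrite mxE.
transitivity (dotv (delta_mx 0 i *m lin1_mx (reflection u))
                   (delta_mx 0 j *m lin1_mx (reflection u))).
  by rewrite -!rowE; apply: eq_bigr => k _; rewrite !mxE.
rewrite !mul_rV_lin1 /= dotv_reflection // /dotv (bigD1 i) //= big1 => [|k ki].
  by rewrite !mxE !eqxx mul1r addr0.
by rewrite !mxE (negbTE ki) mul0r.
Qed.

(** The reflection along [x - y] exchanges two distinct unit vectors. *)
Lemma orthogonal_transitive x y : unit_sphere x -> unit_sphere y ->
  exists A, orthogonal_group A /\ x *m A = y.
Proof.
move=> x1 y1; have [->|xy] := eqVneq x y.
  exists 1%:M; split; last exact: mulmx1.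
  by rewrite /orthogonal_group /= trmx1 mulmx1.
pose n := enorm (x - y); pose v := n^-1 *: (x - y).
have n0 : n != 0 by rewrite enorm_eq0 subr_eq0.
have v1 : unit_sphere v.
  by rewrite /unit_sphere /= /v dotvZl dotvZr -sqr_enorm -/n expr2 mulKf // mulVf.
exists (lin1_mx (reflection v)); split; first exact: orthogonal_reflection.
rewrite mul_rV_lin1 /= /reflection /v dotvZr scalerA.
have -> : 2 * (n^-1 * dotv x (x - y)) * n^-1 = 1.
  have : n ^+ 2 = 2 * dotv x (x - y).
    rewrite sqr_enorm sphere_dist // !dotv_lin (x1 : dotv x x = 1); ring.
  by rewrite mulrCA => <-; rewrite expr2 mulKf // mulfV.
by rewrite scale1r opprB addrC subrK.
Qed.

End Euclidean.

(** * Comparing finite sums through their level sets *)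

Lemma sum_const_seq (R : pzSemiRingType) (I : Type) (s : seq I) (c : R) :
  \sum_(i <- s) c = (size s)%:R * c.
Proof. by rewrite big_const_seq count_predT iter_addr addr0 mulr_natl. Qed.

(** With both lists in decreasing order, domination of the level sets puts each entry of [a] below
    the entry of [b] of the same rank. *)
Lemma sum_le_of_count (R : realDomainType) (a b : seq R) :
  size a = size b ->
  (forall s, (count (fun z => s <= z)%R a <= count (fun z => s <= z)%R b)%N) ->
  \sum_(z <- a) z <= \sum_(z <- b) z.
Proof.
wlog: a b / sorted >=%R a /\ sorted >=%R b => [W|].
  have ge_total : total (>=%R : rel R) by move=> x y; exact: le_total.
  move=> ab cnt; rewrite -(perm_big _ (permEl (perm_sort >=%R a))).
  rewrite -(perm_big _ (permEl (perm_sort >=%R b))); apply: W.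
  - by split; exact: sort_sorted.
  - by rewrite !size_sort.
  - by move=> s; rewrite !count_sort.
have ge_trans : transitive (>=%R : rel R).
  by move=> y x z /= xy yz; exact: le_trans yz xy.
elim: a b => [|x a IH] [|y b] //= [sa sb] [ab] cnt.
have xmax : {in a, forall z, z <= x} by apply/allP; exact: order_path_min sa.
(* At threshold [x] the left count is positive, so some entry of [y :: b] reaches [x], and [y] is
   the largest of them. *)
have xy : x <= y.
  have := cnt x; rewrite lexx; case: leP => // yx.
  rewrite (_ : count _ b = 0)%N //; apply/eqP; rewrite -leqn0 leqNgt -has_count.
  apply/hasPn => z zb; rewrite -ltNge; apply: le_lt_trans yx.
  by have /allP/(_ z zb) := order_path_min ge_trans sb.
rewrite !big_cons lerD // IH //.
  by split; [exact: path_sorted sa | exact: path_sorted sb].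
(* Thresholds up to [x] count both heads, which cancel; above [x] nothing in [a] is counted. *)
move=> s; have [sx|xs] := leP s x.
  by have := cnt s; rewrite sx (le_trans sx xy) !add1n ltnS.
rewrite (_ : count _ a = 0)%N //; apply/eqP; rewrite -leqn0 leqNgt -has_count.
by apply/hasPn => z za; rewrite -ltNge; apply: le_lt_trans xs; exact: xmax.
Qed.

(** * Separated sets and maximal packings of the sphere *)

Section Packings.
Context {R : realType} {d : nat}.
Implicit Types (x y z : 'rV[R]_d) (T : seq 'rV[R]_d) (A : 'M[R]_d).
Implicit Types (e C : R) (g : 'rV[R]_d -> R).

Definition separated e T :=
  {in T, forall x, unit_sphere x} /\
  pairwise (fun x y => e <= enorm (x - y)) T.

(** Pigeonhole: cut $[-1,1]^d$ into cells of side $1/k$ with $d/k<e$; two separated points never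
    share a cell. *)
Lemma separated_bounded e : 0 < e ->
  exists K : nat, forall T, separated e T -> (size T <= K)%N.
Proof.
move=> e0; have [k kE] : exists k : nat, d%:R < k%:R * e.
  exists (Num.truncn (d%:R / e)).+1; rewrite -ltr_pdivrMr //.
  by have /andP[] := truncn_itv (divr_ge0 (ler0n R d) (ltW e0)).
have k0 : 0 < k%:R :> R.
  by rewrite -(pmulr_lgt0 _ e0); exact: le_lt_trans (ler0n _ _) kE.
(* The shift by 1 makes coordinates nonnegative; coordinate 1 gets index [2 * k], hence [2 * k + 1]
   indices per axis. *)
pose c x i : nat := Num.truncn ((x 0 i + 1) * k%:R).
pose cell x := [ffun i : 'I_d => inord (c x i) : 'I_(2 * k).+1].
exists #|{: {ffun 'I_d -> 'I_(2 * k).+1}}| => T [T1 Tsep].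
rewrite -(size_map cell) -(card_uniqP _) ?max_card //.
rewrite uniq_pairwise pairwise_map.
have coord x i : x \in T -> 0 <= (x 0 i + 1) * k%:R <= (2 * k)%:R.
  move=> /T1 x1; have : `|x 0 i| <= 1.
    by rewrite -(sphere_enorm x1) (le_trans (coord_le_norm _ _ _)) ?norm_le_enorm.
  rewrite ler_norml natrM => /andP[l1 l2].
  by rewrite mulr_ge0 ?ler_wpM2r //; lra.
have sub : {in T &, subrel (fun x y => e <= enorm (x - y))
                          (relpre cell [rel x y | x != y])}.
  move=> x y xT yT /=; apply: contraTneq => /ffunP cE; rewrite -ltNge.
  apply: le_lt_trans (enorm_le_norm _) _.
  rewrite -(ltr_pM2r k0) [ltRHS]mulrC; apply: le_lt_trans kE.
  rewrite -mulrA ler_piMr // -ler_pdivlMr // mul1r.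
  rewrite [leLHS]/Num.norm /= mx_normrE; apply/bigmax_leP.
  split=> [|[j i] _] /=; first by rewrite invr_ge0 ltW.
  rewrite ord1 !mxE -[leRHS]mul1r ler_pdivlMr //.
  rewrite -[X in _ * X](ger0_norm (ltW k0)) -normrM.
  have /andP[x0 x2] := coord x i xT; have /andP[y0 y2] := coord y i yT.
  have cxy : c x i = c y i.
    have := congr1 val (cE i); rewrite !ffunE /= !inordK //.
    - by rewrite ltnS -(ler_nat R) (le_trans _ y2) // truncn_le.
    - by rewrite ltnS -(ler_nat R) (le_trans _ x2) // truncn_le.
  have := truncn_itv x0; have := truncn_itv y0; rewrite -/(c x i) -/(c y i) cxy.
  rewrite -natr1 ler_norml => /andP[? ?] /andP[? ?]; apply/andP; split; lra.
by apply: sub_in_pairwise Tsep; [exact: sub | exact/allP].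
Qed.

(** Maximality is in cardinality, not just under inclusion: [packing_sum_le] compares [T] with lists
    that need not contain it. *)
Definition packing e T :=
  separated e T /\ forall T', separated e T' -> (size T' <= size T)%N.

Lemma packing_exists e : 0 < e -> exists T, packing e T.
Proof.
move=> /separated_bounded[K KP].
pose P n := `[< exists2 T, separated e T & size T = n >].
have P0 : exists n, P n by exists 0%N; apply/asboolP; exists [::].
have PK n : P n -> (n <= K)%N by move=> /asboolP[T /KP + <-].
have [n /asboolP[T sT <-] nmax] := ex_maxnP P0 PK.
by exists T; split=> // T' sT'; apply: nmax; apply/asboolP; exists T'.
Qed.

Lemma packing_net e T y : packing e T -> unit_sphere y ->
  exists2 t, t \in T & enorm (t - y) < e.
Proof.
move=> [[T1 Tsep] Tmax] y1; apply: contrapT => nT.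
suff : separated e (y :: T) by move=> /Tmax; rewrite ltnn.
split=> [x|/=]; first by rewrite in_cons => /predU1P[->//|/T1].
rewrite Tsep andbT; apply/allP => t tT; rewrite leNgt; apply/negP => te.
by apply: nT; exists t => //; rewrite enormB.
Qed.

Lemma packing_size_gt0 e T y : packing e T -> unit_sphere y -> (0 < size T)%N.
Proof. by move=> pT y1; have [t] := packing_net pT y1; case: T {pT}. Qed.

(** One constant bounds both size and slope, so that products stay in the class with an explicit
    constant. *)
Definition sphere_lipschitz C g := forall x y, unit_sphere x -> unit_sphere y ->
  `|g x| <= C /\ `|g x - g y| <= C * enorm (x - y).

(* If X is the part of T where g >= s, and Z the part of T A where
   g < s - C e, then X ++ Z is e-separated, so by maximality it is no longer
   than T: the level sets of g on T are dominated by those of g + C e on T A. *)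
Lemma packing_sum_le e T C g A : packing e T -> sphere_lipschitz C g ->
  orthogonal_group A ->
  \sum_(t <- T) g t <= \sum_(t <- T) g (t *m A) + (size T)%:R * (C * e).
Proof.
move=> [[T1 Tsep] Tmax] gC A1.
have -> : \sum_(t <- T) g (t *m A) + (size T)%:R * (C * e) =
          \sum_(t <- T) (g (t *m A) + C * e).
  by rewrite big_split /= sum_const_seq.
rewrite -(big_map g xpredT id) -(big_map (fun t => g (t *m A) + C * e) xpredT id).
apply: sum_le_of_count => [|s]; first by rewrite !size_map.
rewrite !count_map -(leq_add2r (count (fun t => ~~ (s <= g (t *m A) + C * e)%R) T)).
rewrite count_predC -!size_filter.
rewrite -(size_map (mulmx^~ A) [seq t <- T | ~~ (s <= g (t *m A) + C * e)]) -size_cat.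
apply: Tmax; split.
  move=> x; rewrite mem_cat => /orP[|/mapP[z + ->]].
    by rewrite mem_filter => /andP[_ /T1].
  by rewrite mem_filter => /andP[_ /T1]; exact: sphere_orthogonal.
rewrite pairwise_cat; apply/and3P; split.
(* Cross pairs: were [x] and [t *m A] closer than [e], the Lipschitz bound would give
   [s <= g x <= g (t *m A) + C * e]. *)
- apply/allrelP => x z; rewrite mem_filter => /andP[/= sx /T1 x1].
  move=> /mapP[t]; rewrite mem_filter => /andP[/= st /T1 t1] ->.
  rewrite leNgt; apply: contra st => xz.
  have [gx] := gC _ _ x1 (sphere_orthogonal A1 t1).
  rewrite ler_norml => /andP[_ gxt].
  have C0 : 0 <= C := le_trans (normr_ge0 _) gx.
  have : C * enorm (x - t *m A) <= C * e by rewrite ler_wpM2l // ltW.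
  by move: sx => /=; lra.
- by rewrite pairwise_filter.
- rewrite pairwise_map pairwise_filter //; apply: sub_pairwise Tsep => x z /=.
  by rewrite -mulmxBl enorm_orthogonal.
Qed.

End Packings.

(** * Rigidity of Lipschitz functions that are monotone under folds *)

Section Rigidity.
Context {R : realType} {d : nat}.
Implicit Types (x y z u : 'rV[R]_d) (T : seq 'rV[R]_d) (A : 'M[R]_d).
Implicit Types (e C D : R) (f g h : 'rV[R]_d -> R) (G : set 'rV[R]_d).

Lemma sphere_lipschitzM C D f g : sphere_lipschitz C f -> sphere_lipschitz D g ->
  sphere_lipschitz (2 * C * D) (fun x => f x * g x).
Proof.
move=> fC gD x y x1 y1; have [fx fxy] := fC x y x1 y1.
have [gx gxy] := gD x y x1 y1; have [gy _] := gD y x y1 x1.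
have C0 : 0 <= C := le_trans (normr_ge0 _) fx.
have D0 : 0 <= D := le_trans (normr_ge0 _) gx.
split.
  rewrite normrM; apply: le_trans (ler_pM _ _ fx gx) _ => //.
  by rewrite -mulrA mulr_natl mulr2n lerDl mulr_ge0.
have -> : f x * g x - f y * g y = f x * (g x - g y) + (f x - f y) * g y by ring.
apply: le_trans (ler_normD _ _) _; rewrite !normrM.
have -> : 2 * C * D * enorm (x - y) =
          C * (D * enorm (x - y)) + C * enorm (x - y) * D by ring.
by rewrite lerD // ler_pM.
Qed.

Lemma sphere_lipschitzB C D f g : sphere_lipschitz C f -> sphere_lipschitz D g ->
  sphere_lipschitz (C + D) (fun x => f x - g x).
Proof.
move=> fC gD x y x1 y1; have [fx fxy] := fC x y x1 y1.
have [gx gxy] := gD x y x1 y1.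
split; first by rewrite (le_trans (ler_normB _ _)) // lerD.
have -> : f x - g x - (f y - g y) = (f x - f y) - (g x - g y) by ring.
by rewrite (le_trans (ler_normB _ _)) // mulrDl lerD.
Qed.

Lemma sphere_lipschitz_orthogonal C f A : sphere_lipschitz C f ->
  orthogonal_group A -> sphere_lipschitz C (fun x => f (x *m A)).
Proof.
move=> fC A1 x y x1 y1; rewrite -(enorm_orthogonal (x - y) A1) mulmxBl.
by apply: fC; exact: sphere_orthogonal.
Qed.

Lemma sphere_lipschitz_posdot u : unit_sphere u ->
  sphere_lipschitz 1 (fun x => Num.max 0 (dotv x u)).
Proof.
move=> u1 x y x1 y1; split.
  have := dotv_le_enorm x u1; rewrite (sphere_enorm x1) => xu.
  by case: (leP 0 (dotv x u)) => // _; rewrite normr0.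
have := dotv_le_enorm (x - y) u1; rewrite mul1r !dotv_lin !ler_norml.
move=> /andP[? ?]; have := enorm_ge0 (x - y) => ?.
by case: (leP 0 (dotv x u)) => ?; case: (leP 0 (dotv y u)) => ?;
  apply/andP; split; lra.
Qed.

(** The reverse bound is [packing_sum_le] applied to $g\circ A$ and the inverse $A^T$. *)
Lemma packing_sum_ge e T C g A : packing e T -> sphere_lipschitz C g ->
  orthogonal_group A ->
  \sum_(t <- T) g (t *m A) <= \sum_(t <- T) g t + (size T)%:R * (C * e).
Proof.
move=> pT gC A1; have A1' : A^T *m A = 1%:M by apply: mulmx1C.
have oAT : orthogonal_group A^T by rewrite /orthogonal_group /= trmxK.
apply: le_trans (packing_sum_le pT (sphere_lipschitz_orthogonal gC A1) oAT) _.
by under eq_bigr do rewrite -mulmxA A1' mulmx1.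
Qed.

(* Finitely many rotated copies of h have a sum bounded below on the sphere,
   and all of them have nearly the same mean over a fine packing. *)
Lemma packing_mean_gt0 C h x : sphere_lipschitz C h ->
  (forall y, unit_sphere y -> 0 <= h y) -> unit_sphere x -> 0 < h x ->
  exists2 a : R, 0 < a & forall e T, C * e <= a -> packing e T ->
    (size T)%:R * a <= \sum_(t <- T) h t.
Proof.
move=> hC h0 x1 hx.
have C0 : 0 < C.
  by apply: lt_le_trans hx _; rewrite (le_trans (ler_norm _)) //; have [] :=
    hC x x x1 x1.
have r0 : 0 < h x / (2 * C) by rewrite divr_gt0 // mulr_gt0.
have [S pS] := @packing_exists R d _ r0.
have S0 : 0 < (size S)%:R :> R by rewrite ltr0n (packing_size_gt0 pS x1).
(* Each net point [t] is moved to [x] by [A t]; off the sphere, 0 is a default value. *)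
have /choice[A AP] : forall t, exists A, unit_sphere t ->
    orthogonal_group A /\ t *m A = x.
  move=> t; have [t1|nt1] := pselect (unit_sphere t); last by exists 0.
  by have [A ?] := orthogonal_transitive t1 x1; exists A.
(* A net point [t] within [h x / (2 * C)] of [y] puts [y *m A t] that close to [x], so its term
   alone is at least [h x / 2]. *)
have low y : unit_sphere y -> h x / 2 <= \sum_(t <- S) h (y *m A t).
  move=> y1; have [t tS ty] := packing_net pS y1.
  have t1 : unit_sphere t by apply: (proj1 (proj1 pS)).
  have [A1 tA] := AP t t1.
  have : h x / 2 <= h (y *m A t).
    have [_] := hC _ _ x1 (sphere_orthogonal A1 y1).
    rewrite -[in enorm _]tA -mulmxBl enorm_orthogonal // ler_norml => /andP[_].
    have : C * enorm (t - y) <= C * (h x / (2 * C)) by rewrite ler_wpM2l // ltW.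
    have -> : C * (h x / (2 * C)) = h x / 2 by field; rewrite gt_eqF.
    by lra.
  move=> /le_trans; apply; rewrite (big_rem t) //= lerDl big_seq.
  apply: sumr_ge0 => s /mem_rem sS; apply: h0; apply: sphere_orthogonal => //.
  by case: (AP s (proj1 (proj1 pS) _ sS)).
(* Summing [low] over [T] and exchanging sums bounds the mean of [h] below by
   $h(x)/(2|S|)-Ce=2a-Ce\ge a$. *)
exists (h x / (4 * (size S)%:R)) => [|e T Ce pT].
  by rewrite divr_gt0 // mulr_gt0.
set a := h x / _ in Ce *.
have aE : h x = a * (4 * (size S)%:R) by rewrite /a divfK // gt_eqF // mulr_gt0.
have up : (size T)%:R * (h x / 2) <=
    (size S)%:R * (\sum_(t <- T) h t + (size T)%:R * (C * e)).
  rewrite -(sum_const_seq T (h x / 2)) -(sum_const_seq S).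
  apply: (@le_trans _ _ (\sum_(y <- T) \sum_(t <- S) h (y *m A t))).
    by rewrite !big_seq; apply: ler_sum => y yT; apply/low/(proj1 (proj1 pT)).
  rewrite exchange_big /= [leLHS]big_seq [leRHS]big_seq.
  apply: ler_sum => t tS.
  by apply: packing_sum_ge => //; case: (AP t (proj1 (proj1 pS) _ tS)).
rewrite -(ler_pM2l S0); have T0 := ler0n R (size T).
have : (size S)%:R * ((size T)%:R * (C * e)) <= (size S)%:R * ((size T)%:R * a).
  by do 2![rewrite ler_wpM2l //].
have : (size T)%:R * (h x / 2) = 2 * ((size S)%:R * ((size T)%:R * a)).
  by rewrite aE; field.
by move: up; rewrite mulrDr; lra.
Qed.

Lemma sphere_compact : compact (unit_sphere : set 'rV[R]_d).
Proof.
apply: bounded_closed_compact.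
  exists 1; split; first exact: num_real.
  move=> r r1 x /= x1; apply: le_trans (norm_le_enorm x) _.
  by rewrite (sphere_enorm x1) ltW.
apply: (@preimage_closed _ _ (fun x : 'rV[R]_d => dotv x x) [set r | r = 1]) => [x _|].
  apply: (continuous_big (P := xpredT) add_continuous
    (F := fun i (y : 'rV[R]_d) => y 0 i * y 0 i)) => i _ y.
  by apply: cvgM; [exact: (nbhs_filter y) | exact: (@coord_continuous R 1 d 0 i y)..].
exact: closed_eq.
Qed.

(** Compactness: if every margin $1/(n+1)$ failed at some $v_n$, a cluster point of $(v_n)$ would
    lie in no $H_u$. *)
Lemma cover_margin G :
  unit_sphere `<=` \bigcup_(u in G) open_half_space u ->
  G `<=` unit_sphere ->
  exists2 a : R, 0 < a &
    forall v, unit_sphere v -> exists2 u, G u & a <= dotv v u.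
Proof.
move=> cov hG; apply: contrapT => na.
have /choice[v vP] : forall n : nat, exists v, unit_sphere v /\
    forall u, G u -> dotv v u < n.+1%:R^-1.
  move=> n; apply: contrapT => nv; apply: na.
  exists n.+1%:R^-1; first by rewrite invr_gt0.
  move=> v v1; apply: contrapT => nu; apply: nv; exists v; split=> // u Gu.
  by rewrite ltNge; apply/negP => uv; apply: nu; exists u.
have vS : (v @ \oo) unit_sphere by exists 0%N => // n _; exact: (vP n).1.
have [w [w1 wcl]] := @sphere_compact (v @ \oo) _ vS.
have [u Gu uw] := cov w w1; rewrite /open_half_space /= in uw.
(* Sup-norm radius [b / d.+1] gives Euclidean distance at most [b], so [dotv (v n) u >= b] although
   it is below $1/(n+1)<b$. *)
pose b := dotv w u / 2; have b0 : 0 < b by rewrite divr_gt0.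
have [||y [[n nb <-] yw]] := wcl [set v n | n in [set n : nat | n.+1%:R^-1 < b]]
    (ball w (b / d.+1%:R)).
- have := @near_infty_natSinv_lt R (PosNum b0); apply: filterS => n nb.
  by exists n.
- by apply: nbhsx_ballx; rewrite divr_gt0.
move: yw; rewrite -ball_normE /= => yw.
have := dotv_le_enorm (w - v n) (hG u Gu).
have : enorm (w - v n) <= b.
  apply: le_trans (enorm_le_norm _) _.
  have : d%:R * `|w - v n| <= d.+1%:R * (b / d.+1%:R).
    by rewrite ler_pM // ?ler_nat // ltW.
  by rewrite [_ * (b / _)]mulrC divfK // pnatr_eq0.
have := (vP n).2 u Gu; rewrite !dotv_lin ler_norml => h1 h2 /andP[_ h3].
have := le_trans h3 h2; have := lt_trans h1 nb; rewrite /b.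
by move: (dotv w u) (dotv (v n) u) => r s; lra.
Qed.

(* With h = (f - f R_u) (x.u)^+ >= 0 and M the barycentre of a fine packing
   weighted by f, approximate invariance gives M.u >= sum h up to a small
   error, for all u in G. So M.u is almost nonnegative for all u in G, which the
   covering condition only allows if M is almost 0; hence h vanishes. *)
Lemma fold_monotone_reflection G C f : G `<=` unit_sphere ->
  unit_sphere `<=` \bigcup_(u in G) open_half_space u ->
  sphere_lipschitz C f ->
  (forall u x, G u -> unit_sphere x -> f x <= f (fold u x)) ->
  forall u x, G u -> unit_sphere x -> f (reflection u x) = f x.
Proof.
move=> hG cov fC fF.
(* On the positive side, [x] is the fold of its own mirror image. *)
have fR u x : G u -> unit_sphere x -> 0 < dotv x u -> f (reflection u x) <= f x.
  move=> Gu x1 xu; have u1 := hG u Gu.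
  have := fF u (reflection u x) Gu (sphere_reflection u1 x1).
  by rewrite /fold dotv_reflectionl // oppr_gt0 ltNge (ltW xu) /= reflectionK.
suff pos u x : G u -> unit_sphere x -> 0 < dotv x u -> f (reflection u x) = f x.
  move=> u x Gu x1; have u1 := hG u Gu.
  have [xu|xu|xu] := ltgtP (dotv x u) 0.
  - rewrite -[in RHS](reflectionK u1 x) [RHS]pos //; first exact: sphere_reflection.
    by rewrite dotv_reflectionl // oppr_gt0.
  - exact: pos.
  - by rewrite /reflection xu mulr0 scale0r subr0.
move=> Gu x1 xu; apply/eqP; rewrite eq_le fR //= leNgt; apply/negP => lt_f.
pose p v y : R := Num.max 0 (dotv y v).
pose h v y : R := (f y - f (y *m lin1_mx (reflection v))) * p v y.
have hE v y : h v y = (f y - f (reflection v y)) * p v y by rewrite /h mul_rV_lin1.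
have C0 : 0 <= C := le_trans (normr_ge0 _) (proj1 (fC x x x1 x1)).
have h0 v y : G v -> unit_sphere y -> 0 <= h v y.
  move=> Gv y1; rewrite hE /p; case: (leP 0 (dotv y v)); last by rewrite mulr0.
  rewrite le_eqVlt => /predU1P[<-|yv]; first by rewrite mulr0.
  by rewrite mulr_ge0 ?subr_ge0 ?fR // ltW.
have u1 := hG u Gu.
have hL : sphere_lipschitz (2 * (C + C) * 1) (h u).
  apply: sphere_lipschitzM; last exact: sphere_lipschitz_posdot.
  apply: sphere_lipschitzB => //; apply: sphere_lipschitz_orthogonal => //.
  exact: orthogonal_reflection.
have hx : 0 < h u x by rewrite hE mulr_gt0 ?subr_gt0 // /p lt_max xu orbT.
have [a a0 aP] := packing_mean_gt0 hL (fun y => h0 u y Gu) x1 hx.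
have [b b0 bP] := cover_margin cov hG.
(* [h u] has constant [4 * C]: the first bound makes [aP] applicable and keeps the error [2 * C * e]
   below [a / 2]; the second yields the final contradiction. *)
have [e e0 [ea eb]] : exists2 e, 0 < e & 8 * C * e <= a /\ 8 * C * e < b * a.
  pose c := Num.min a (b * a) / 2; have c0 : 0 < c.
    by rewrite divr_gt0 // lt_min a0 mulr_gt0.
  have Cc : 8 * C / (8 * C + 1) * c <= c.
    by rewrite ler_piMl ?(ltW c0) // ler_pdivrMr ?mul1r; lra.
  have cm : c < Num.min a (b * a).
    by rewrite /c ltr_pdivrMr // ltr_pMr ?ltr1n // lt_min a0 mulr_gt0.
  move: cm; rewrite lt_min => /andP[ca cb].
  (* The [+ 1] keeps the denominator positive when [C = 0]. *)
  exists (c / (8 * C + 1)); first by rewrite divr_gt0 //; lra.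
  rewrite mulrA mulrAC; split; first by rewrite (le_trans Cc) // ltW.
  exact: le_lt_trans cb.
have [T pT] := @packing_exists R d _ e0.
have N0 : 0 < (size T)%:R :> R by rewrite ltr0n (packing_size_gt0 pT x1).
pose M := \sum_(t <- T) f t *: t.
have Mlow v : G v ->
    \sum_(t <- T) h v t - (size T)%:R * (2 * C * e) <= dotv M v.
  move=> Gv; have v1 := hG v Gv; have ov := orthogonal_reflection v1.
  (* [q] is the negative part of $y\cdot v$, so [dotv M v] sums [f * (p v - q)]; approximate
     invariance is applied to [f * q] only, as the reflection turns [q] into [p v]. *)
  pose q y : R := p v (y *m lin1_mx (reflection v)).
  have qL : sphere_lipschitz (2 * C * 1) (fun y => f y * q y).
    apply: sphere_lipschitzM => //; apply: sphere_lipschitz_orthogonal => //.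
    exact: sphere_lipschitz_posdot.
  have := packing_sum_le pT qL ov; rewrite mulr1 => qsum.
  have -> : dotv M v = \sum_(t <- T) f t * p v t - \sum_(t <- T) f t * q t.
    rewrite dotv_suml -sumrB; apply: eq_bigr => t _; rewrite dotvZl -mulrBr.
    rewrite /q mul_rV_lin1 /p dotv_reflectionl //; congr (_ * _).
    by rewrite oppr_max oppr0 opprK; case: ltgtP => //; lra.
  have -> : \sum_(t <- T) h v t = \sum_(t <- T) f t * p v t -
      \sum_(t <- T) f (t *m lin1_mx (reflection v)) * q (t *m lin1_mx (reflection v)).
    rewrite -sumrB; apply: eq_bigr => t _.
    by rewrite hE /q !mul_rV_lin1 /= reflectionK // mulrBl.
  by lra.
have hsum0 v : G v -> 0 <= \sum_(t <- T) h v t.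
  by move=> Gv; rewrite big_seq sumr_ge0 // => t tT; apply/h0/(proj1 (proj1 pT)).
have Mu : (size T)%:R * (a / 2) <= enorm M.
  have := dotv_le_enorm M u1; have := Mlow u Gu.
  have := aP e T _ pT; rewrite (_ : _ <= a); last by lra.
  move=> /(_ isT); have : (size T)%:R * (2 * C * e) <= (size T)%:R * (a / 2).
    by rewrite ler_wpM2l ?(ltW N0) //; lra.
  by rewrite ler_norml => ? ? ? /andP[_ ?]; lra.
have M0 : 0 < enorm M by apply: lt_le_trans Mu; rewrite mulr_gt0 // divr_gt0.
(* In the direction opposite to [M], the margin provides [w] in [G] with $M\cdot w\le -b|M|$, too
   negative for [Mlow]. *)
pose v := - (enorm M)^-1 *: M.
have v1 : unit_sphere v.
  rewrite /unit_sphere /= /v !dotv_lin -sqr_enorm.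
  by field; rewrite gt_eqF.
have [w Gw bw] := bP v v1.
have := Mlow w Gw; have := hsum0 w Gw.
have : b * enorm M <= - dotv M w.
  move: bw; rewrite /v dotvZl mulNr mulrC -mulNr => bw.
  by rewrite -ler_pdivlMr.
have : b * ((size T)%:R * (a / 2)) <= b * enorm M by rewrite ler_wpM2l // ltW.
have : (size T)%:R * (8 * C * e) < (size T)%:R * (b * a) by rewrite ltr_pM2l.
by nra.
Qed.

End Rigidity.

(** * From invariance to constancy, and points reachable by words of folds *)

Section Reachability.
Context {R : realType} {d : nat}.
Implicit Types (x y z u : 'rV[R]_d) (A B : 'M[R]_d) (w : seq 'rV[R]_d).
Implicit Types (e C : R) (f : 'rV[R]_d -> R) (G : set 'rV[R]_d).

(** This makes the stabilizer of [f] a competitor in the definition of [reflection_group] as a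
    smallest subgroup. *)
Lemma orthogonal_subgroup_stabilizer (X : Type) (f : 'rV[R]_d -> X) :
  orthogonal_subgroup [set A | orthogonal_group A /\
    forall x, unit_sphere x -> f (x *m A) = f x].
Proof.
have orthV A : orthogonal_group A -> invmx A = A^T.
  move=> A1; have [uA _] := mulmx1_unit A1.
  by rewrite -[LHS]mulmx1 -(A1 : A *m A^T = _) mulKmx.
split=> [A []//||A B [A1 fA] [B1 fB]|A [A1 fA]].
- by split=> [|x _]; rewrite ?mulmx1 // /orthogonal_group /= trmx1 mulmx1.
- split=> [|x x1]; last by rewrite mulmxA fB ?fA //; exact: sphere_orthogonal.
  by rewrite /orthogonal_group /= trmx_mul mulmxA -(mulmxA A) B1 mulmx1.
- have A'1 : orthogonal_group (invmx A).
    by rewrite orthV // /orthogonal_group /= trmxK; exact: mulmx1C.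
  split=> // x x1; rewrite -fA; last exact: sphere_orthogonal.
  by rewrite mulmxKV //; case: (mulmx1_unit A1).
Qed.

Lemma reflection_group_invariant (X : Type) (f : 'rV[R]_d -> X) G :
  G `<=` unit_sphere ->
  (forall u x, G u -> unit_sphere x -> f (reflection u x) = f x) ->
  forall A x, reflection_group G A -> unit_sphere x -> f (x *m A) = f x.
Proof.
move=> hG fR A x GA x1.
have [|_ ->//] := GA [set A | orthogonal_group A /\
  forall x, unit_sphere x -> f (x *m A) = f x].
split; first exact: orthogonal_subgroup_stabilizer.
move=> _ [u Gu <-]; split; first exact/orthogonal_reflection/hG.
by move=> y y1; rewrite mul_rV_lin1 fR.
Qed.

Lemma enorm_mulmx_le x A : unit_sphere x -> enorm (x *m A) <= d%:R ^+ 2 * `|A|.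
Proof.
move=> x1; apply: le_trans (enorm_le_norm _) _; rewrite expr2 -mulrA ler_wpM2l //.
rewrite [leLHS]/Num.norm /= mx_normrE; apply/bigmax_leP.
split=> [|[i j] _] /=; first exact: mulr_ge0.
rewrite mxE (le_trans (ler_norm_sum _ _ _)) //.
have -> : d%:R * `|A| = \sum_(k < d) `|A| by rewrite sumr_const card_ord mulr_natl.
apply: ler_sum => k _.
rewrite normrM -[leRHS]mul1r ler_pM ?coord_le_norm //.
by rewrite -(sphere_enorm x1) (le_trans (coord_le_norm _ _ _)) ?norm_le_enorm.
Qed.

Lemma orthogonal_invariant C f (H : set 'M[R]_d) : sphere_lipschitz C f ->
  dense_in orthogonal_group H ->
  (forall A x, H A -> unit_sphere x -> f (x *m A) = f x) ->
  forall A x, orthogonal_group A -> unit_sphere x -> f (x *m A) = f x.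
Proof.
move=> fC [Hsub Hdense] fH A x A1 x1; apply/eqP; rewrite -subr_eq0 -normr_eq0.
rewrite eq_le normr_ge0 andbT; apply/ler_addgt0Pr => e e0; rewrite add0r.
have C0 : 0 <= C := le_trans (normr_ge0 _) (proj1 (fC x x x1 x1)).
(* [d%:R ^+ 2] comes from [enorm_mulmx_le]; the [+ 1] keeps [k] positive. *)
pose k := C * d%:R ^+ 2 + 1.
have k0 : 0 < k by rewrite ltr_wpDl // mulr_ge0 // exprn_ge0.
have [B [HB AB]] := Hdense A A1 (ball A (e / k)) (nbhsx_ballx A _ (divr_gt0 e0 k0)).
rewrite -(fH B x HB x1).
have [_] := fC _ _ (sphere_orthogonal A1 x1) (sphere_orthogonal (Hsub B HB) x1).
move=> /le_trans; apply; rewrite -mulmxBr.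
move: AB; rewrite -ball_normE /= => AB.
apply: (@le_trans _ _ (k * `|A - B|)); last by rewrite mulrC -ler_pdivlMr // ltW.
rewrite mulrDl mul1r ler_wpDr // -mulrA ler_wpM2l //.
exact: enorm_mulmx_le.
Qed.

(** Invariance passes from the reflections to their group, by density and continuity to $O(d)$,
    which is transitive on the sphere. *)
Lemma fold_monotone_constant G C f : G `<=` unit_sphere ->
  unit_sphere `<=` \bigcup_(u in G) open_half_space u ->
  dense_in orthogonal_group (reflection_group G) ->
  sphere_lipschitz C f ->
  (forall u x, G u -> unit_sphere x -> f x <= f (fold u x)) ->
  forall x y, unit_sphere x -> unit_sphere y -> f x = f y.
Proof.
move=> hG cov dG fC fF x y x1 y1.
have [A [A1 <-]] := orthogonal_transitive x1 y1; apply/esym.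
apply: (orthogonal_invariant fC dG) => //.
exact: reflection_group_invariant (fold_monotone_reflection hG cov fC fF).
Qed.

Definition fold_word w x := foldl (fun z u => fold u z) x w.

Lemma fold_word_cat w w' x : fold_word (w ++ w') x = fold_word w' (fold_word w x).
Proof. exact: foldl_cat. Qed.

Lemma sphere_fold_word w x : {in w, forall u, unit_sphere u} ->
  unit_sphere x -> unit_sphere (fold_word w x).
Proof.
elim: w x => //= u w IH x w1 x1; apply: IH => [v vw|].
  by apply: w1; rewrite in_cons vw orbT.
by apply: sphere_fold => //; apply: w1; rewrite in_cons eqxx.
Qed.

Lemma enorm_fold_word w x y : {in w, forall u, unit_sphere u} ->
  enorm (fold_word w x - fold_word w y) <= enorm (x - y).
Proof.
elim: w x y => //= u w IH x y w1.
apply: le_trans (IH _ _ _) (enorm_fold _ _ _) => [v vw|].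
  by apply: w1; rewrite in_cons vw orbT.
by apply: w1; rewrite in_cons eqxx.
Qed.

(* The support function of the set reachable from x is monotone under the
   folds, hence constant; it is at least 1 at x, so at every y there are
   reachable points z with y.z close to 1. *)
Lemma fold_word_reach G : G `<=` unit_sphere ->
  unit_sphere `<=` \bigcup_(u in G) open_half_space u ->
  dense_in orthogonal_group (reflection_group G) ->
  forall x y e, unit_sphere x -> unit_sphere y -> 0 < e ->
  exists w, {in w, forall u, G u} /\ enorm (fold_word w x - y) < e.
Proof.
move=> hG cov dG x y e x1 y1 e0.
pose E z := [set dotv z (fold_word w x) |
    w in [set w : seq 'rV[R]_d | {in w, forall u, G u}]].
pose f z := sup (E z).
have w1 w : {in w, forall u, G u} -> unit_sphere (fold_word w x).
  by move=> wG; apply: sphere_fold_word => // u /wG /hG.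
have Eub z : unit_sphere z -> ubound (E z) 1.
  move=> z1 _ [w wG <-]; have := dotv_le_enorm z (w1 w wG).
  by rewrite (sphere_enorm z1); exact: le_trans (ler_norm _).
have E0 z : E z !=set0 by exists (dotv z x); exists [::].
have leE z w : unit_sphere z -> {in w, forall u, G u} ->
    dotv z (fold_word w x) <= f z.
  by move=> z1 wG; apply: ub_le_sup; [exists 1; exact: Eub | exists w].
have fL : sphere_lipschitz 1 f.
  have f_le z v : unit_sphere z -> unit_sphere v -> f z <= f v + enorm (z - v).
    move=> z1 v1; apply: ge_sup => // _ [w wG <-].
    have := leE v w v1 wG; have := dotv_le_enorm (z - v) (w1 w wG).
    by rewrite dotvDl dotvNl ler_norml => /andP[_ ?]; lra.
  move=> z v z1 v1; split.
    rewrite ler_norml ge_sup ?andbT //; last exact: Eub.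
    have := leE z [::] z1 (fun _ => False_ind _ \o notF).
    have := dotv_le_enorm z x1; rewrite (sphere_enorm z1) ler_norml.
    by move=> /andP[? _] /=; exact: le_trans.
  have := f_le z v z1 v1; have := f_le v z v1 z1; rewrite (enormB v) mul1r.
  by rewrite ler_norml => ? ?; apply/andP; split; lra.
(* Folding both [z] and a reachable point does not lower their inner product, and the folded point
   is reachable by one more letter. *)
have fF u z : G u -> unit_sphere z -> f z <= f (fold u z).
  move=> Gu z1; have u1 := hG u Gu; apply: ge_sup => // _ [w wG <-].
  apply: le_trans (dotv_fold _ _ u1) _.
  have -> : fold u (fold_word w x) = fold_word (rcons w u) x.
    by rewrite -cats1 fold_word_cat.
  apply: leE; first exact: sphere_fold.
  by move=> v; rewrite mem_rcons in_cons => /predU1P[->//|/wG].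
have fy : 1 <= f y.
  rewrite -(fold_monotone_constant hG cov dG fL fF x1 y1).
  by rewrite -[leLHS](x1 : dotv x x = 1); exact: (leE x [::]).
have supE : has_sup (E y) by split=> //; exists 1; exact: Eub.
(* On the sphere $|p-y|^2=2-2\,p\cdot y$, so an inner product above $1-e^2/2$ means distance below
   [e]. *)
have e20 : 0 < e ^+ 2 / 2 by rewrite divr_gt0 // exprn_gt0.
have [_ [w wG <-] wy] := sup_adherent e20 supE.
exists w; split=> //.
rewrite -(@ltr_pXn2r _ 2) ?nnegrE ?enorm_ge0 ?ltW // sqr_enorm.
rewrite sphere_dist //; last exact: w1.
by rewrite dotvC; move: wy fy; rewrite -/(f y); lra.
Qed.

End Reachability.

(** * Universal words and their concatenation into one sequence *)

Section Universality.
Context {R : realType} {d : nat}.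
Implicit Types (x y z u : 'rV[R]_d) (w : seq 'rV[R]_d) (e : R).
Implicit Types (G : set 'rV[R]_d).

(* Folds do not increase distances, so handling a finite net of starting points
   and targets, one pair after the other, handles all of them at once. *)
Lemma universal_word G : G `<=` unit_sphere ->
  (forall x y e, unit_sphere x -> unit_sphere y -> 0 < e ->
    exists w, {in w, forall u, G u} /\ enorm (fold_word w x - y) < e) ->
  forall e, 0 < e -> exists w, {in w, forall u, G u} /\
    forall x y, unit_sphere x -> unit_sphere y ->
    exists a b, w = a ++ b /\ `|fold_word a x - y| < e.
Proof.
(* The three thirds: replacing [x] by a net point, steering that point to a net target, and
   replacing the target by [y]. *)
move=> hG reach e e0; have e30 : 0 < e / 3 by rewrite divr_gt0.
have visit (L : seq ('rV[R]_d * 'rV[R]_d)) :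
    {in L, forall p, unit_sphere p.1 /\ unit_sphere p.2} ->
    exists w, {in w, forall u, G u} /\ {in L, forall p,
      exists a b, w = a ++ b /\ enorm (fold_word a p.1 - p.2) < e / 3}.
  elim: L => [|p L IH] L1; first by exists [::].
  have [q qL|w [wG wL]] := IH; first by apply: L1; rewrite in_cons qL orbT.
  have [p1 p2] := L1 p (mem_head _ _).
  have w1 : unit_sphere (fold_word w p.1).
    by apply: sphere_fold_word => // u /wG /hG.
  have [v [vG vp]] := reach _ _ _ w1 p2 e30.
  exists (w ++ v); split=> [u|q].
    by rewrite mem_cat => /orP[/wG|/vG].
  rewrite in_cons => /predU1P[->|/wL[a [b [-> ab]]]].
    by exists (w ++ v), [::]; rewrite cats0 fold_word_cat.
  by exists a, (b ++ v); rewrite catA.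
have [T pT] := @packing_exists R d _ e30.
have [|w [wG wT]] := visit [seq (s, t) | s <- T, t <- T].
  by move=> p /allpairsP[[s t] /= [sT tT ->]]; split; apply: (proj1 (proj1 pT)).
exists w; split=> // x y x1 y1.
have [s sT sx] := packing_net pT x1; have [t tT ty] := packing_net pT y1.
have /wT [a [b [wab ast]]] : (s, t) \in [seq (s, t) | s <- T, t <- T].
  by apply: allpairs_f.
exists a, b; split=> //=.
have aG : {in a, forall u, unit_sphere u}.
  by move=> u ua; apply/hG/wG; rewrite wab mem_cat ua.
have -> : fold_word a x - y =
    (fold_word a x - fold_word a s) + (fold_word a s - t) + (t - y).
  by rewrite !addrA !subrK.
have := le_trans (norm_le_enorm _) (enorm_fold_word x s aG).
have := norm_le_enorm (fold_word a s - t); have := norm_le_enorm (t - y).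
have := ler_normD (fold_word a x - fold_word a s + (fold_word a s - t)) (t - y).
have := ler_normD (fold_word a x - fold_word a s) (fold_word a s - t).
by rewrite (enormB x) /= in ast *; lra.
Qed.

Lemma sequence_of_words (X : Type) (W : nat -> seq X) (x0 : X) :
  (forall n, (0 < size (W n))%N) ->
  exists us : nat -> X, forall n i,
    (i < size (flatten [seq W k | k <- iota 0 n]))%N ->
    us i.+1 = nth x0 (flatten [seq W k | k <- iota 0 n]) i.
Proof.
move=> W0; pose pre n := flatten [seq W k | k <- iota 0 n].
have preD m n : pre (m + n)%N = pre m ++ flatten [seq W k | k <- iota m n].
  by rewrite /pre iotaD map_cat flatten_cat.
have pre_size n : (n <= size (pre n))%N.
  elim: n => // n IH; rewrite -addn1 preD size_cat leq_add //=.
  by rewrite cats0 W0.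
(* Nonempty words make [pre n] at least [n] long, so letter [n.-1] exists for [n >= 1]; only [us 0]
   is the default [x0]. *)
exists (fun n => nth x0 (pre n) n.-1) => n i ilt; rewrite -/(pre n) /=.
have [ni|/ltnW ni] := leqP i.+1 n.
  by rewrite -(subnKC ni) preD nth_cat pre_size.
by rewrite -(subnKC ni) preD nth_cat ilt.
Qed.

Lemma trajectory_fold_word (us : nat -> 'rV[R]_d) x w :
  (forall i, (i < size w)%N -> us i.+1 = nth 0 w i) ->
  trajectory us x (size w) = fold_word w x.
Proof.
elim/last_ind: w => // w u IH usw.
rewrite size_rcons /= usw ?size_rcons // nth_rcons ltnn eqxx IH => [|i iw].
  by rewrite -cats1 fold_word_cat.
by rewrite usw ?size_rcons ?leqW // nth_rcons iw.
Qed.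

End Universality.

Theorem theorem1 (R : realType) (d : nat) (hd : (0 < d)%N)
    (G : set 'rV[R]_d) (hG : G `<=` unit_sphere)
    (C1 : unit_sphere `<=` \bigcup_(u in G) open_half_space u)
    (C2 : dense_in orthogonal_group (reflection_group G)) :
  exists us : nat -> 'rV[R]_d,
    (forall n : nat, (1 <= n)%N -> G (us n)) /\
    forall x : 'rV[R]_d, unit_sphere x ->
      dense_in unit_sphere (range (trajectory us x)).
Proof.
(* As [d > 0], a basis vector is a unit vector, and some half-space must cover it. *)
have [u0 Gu0] : exists u, G u.
  have [|u Gu _] := C1 (delta_mx 0 (Ordinal hd)); last by exists u.
  rewrite /unit_sphere /= /dotv (bigD1 (Ordinal hd)) //= big1 => [|i /negbTE ni].
    by rewrite !mxE !eqxx mul1r addr0.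
  by rewrite !mxE ni mul0r.
have /choice[W WP] : forall n : nat, exists w : seq 'rV[R]_d,
    [/\ (0 < size w)%N, {in w, forall u, G u} &
     forall x y, unit_sphere x -> unit_sphere y ->
     exists a b, w = a ++ b /\ `|fold_word a x - y| < n.+1%:R^-1].
  move=> n; have n0 : 0 < n.+1%:R^-1 :> R by rewrite invr_gt0.
  have [w [wG wP]] := universal_word hG (fold_word_reach hG C1 C2) n0.
  (* Appending [u0] makes the word nonempty and keeps all its old prefixes. *)
  exists (rcons w u0); split=> [|u|x y x1 y1]; first by rewrite size_rcons.
    by rewrite mem_rcons in_cons => /predU1P[->//|/wG].
  have [a [b [-> ab]]] := wP x y x1 y1.
  by exists a, (rcons b u0); rewrite rcons_cat.
have [us usP] := sequence_of_words 0 (fun n => let: And3 h _ _ := WP n in h).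
pose pre n := flatten [seq W k | k <- iota 0 n].
have preG n : {in pre n, forall u, G u}.
  by move=> u /flatten_mapP[k _]; have [_ + _] := WP k; apply.
have preS n : pre n.+1 = pre n ++ W n.
  by rewrite /pre -(addn1 n) iotaD map_cat flatten_cat /= cats0.
have usG n : (1 <= n)%N -> G (us n).
  have pre_size m : (m <= size (pre m))%N.
    elim: m => // m IH; rewrite preS size_cat -addn1 leq_add //.
    by case: (WP m).
  by case: n => // n _; rewrite (usP n.+1) ?pre_size //; apply/preG/mem_nth/pre_size.
exists us; split=> // x x1; split=> [_ [n _ <-]|y y1 U].
  elim: n => //= n IH; apply: sphere_fold => //.
  exact/hG/usG.
move=> /nbhs_ballP[e /= e0 eU].
have [n _ /(_ n (leqnn n)) ne] := @near_infty_natSinv_lt R (PosNum e0).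
have [_ _ Wn] := WP n.
(* Word [n] works from every starting point, in particular from the one reached after the first [n]
   words. *)
have xn : unit_sphere (fold_word (pre n) x).
  by apply: sphere_fold_word => // u /preG /hG.
have [a [b [ab near_y]]] := Wn _ _ xn y1.
exists (trajectory us x (size (pre n ++ a))); split; first by exists (size (pre n ++ a)).
apply: eU; rewrite -ball_normE /= distrC trajectory_fold_word.
  by rewrite fold_word_cat; apply: lt_trans ne.
move=> i ilt; rewrite (usP n.+1) -/(pre n.+1) preS ab catA ?nth_cat ?ilt //.
by rewrite size_cat ltn_addr.
Qed.
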